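(* Let $\mathbb F$ be a field, $n\geqslant 1$, $A,B,F,G\in\mathcal M_n(\mathbb F)$, and assume that $$\begin{pmatrix}F&G\\ B&A\end{pmatrix}\quad\text{and}\quad\begin{pmatrix}A&B\\ G&F\end{pmatrix}$$ are invertible. Let $c=(c_k)_{k\in\mathbb Z}$ with $c_k\in\mathbb F^n$, let $h\in\mathbb F^n$, and let $W$ be a linear boundary operator with values in $\mathbb F^n$, defined on a linear subspace of $\mathcal F(\mathbb Z,\mathbb F^n)$. Consider the problem $$Fx_{k+1}+Gx_{-k-1}+Ax_k+Bx_{-k}=c_k,\ k\in\mathbb Z,\qquad Wx=h.$$ Put $$X:=\left(\left[-\begin{pmatrix}F&G\\ B&A\end{pmatrix}^{-1}\begin{pmatrix}A&B\\ G&F\end{pmatrix}\right]^k\right)_{k\in\mathbb Z},\quad Y:=\overline H\begin{pmatrix}F&G\\ B&A\end{pmatrix}^{-1}\begin{pmatrix}c\\ D\varphi^*c\end{pmatrix},\quad Z:=\begin{pmatrix}W\\ W\varphi^*\end{pmatrix}X.$$ Provided all of the terms involved are well defined and the $2n\times2n$ matrix $Z$ is invertible, the sequence $$u=\pi_1\left(XZ^{-1}\left[\begin{pmatrix}h\\ h\end{pmatrix}-\begin{pmatrix}W\\ W\varphi^*\end{pmatrix}Y\right]+Y\right)$$ is the unique solution of the problem.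
   Context: $\mathcal F(\mathbb Z,\mathbb F^n)$ is the space of sequences $x=(x_k)_{k\in\mathbb Z}$ in $\mathbb F^n$; $D$ is the shift $(Dx)_k=x_{k+1}$ and $\varphi^*$ the reflection $(\varphi^*x)_k=x_{-k}$, so $(D\varphi^*c)_k=c_{-k-1}$. Sequences in $\mathbb F^{2n}=\mathbb F^n\times\mathbb F^n$ are written as columns $\begin{pmatrix}u\\ v\end{pmatrix}$ with $u,v\in\mathcal F(\mathbb Z,\mathbb F^n)$, and matrices act on sequences termwise. The boundary operator acts blockwise: $\begin{pmatrix}W\\ W\varphi^*\end{pmatrix}\begin{pmatrix}u\\ v\end{pmatrix}:=\begin{pmatrix}Wu\\ W\varphi^*v\end{pmatrix}\in\mathbb F^{2n}$, which is well defined when $u$ and $\varphi^*v$ lie in the domain of $W$. $X$ is a sequence of $2n\times2n$ matrices; for $r\in\mathbb F^{2n}$, $Xr$ is the sequence $(X_kr)_{k\in\mathbb Z}$ in $\mathbb F^{2n}$, and $Z\in\mathcal M_{2n}(\mathbb F)$ is the matrix with $Zr=\begin{pmatrix}W\\ W\varphi^*\end{pmatrix}(Xr)$. The map $\pi_1:\mathbb F^n\times\mathbb F^n\to\mathbb F^n$, $\pi_1(x,y)=x$, is applied termwise. ''Unique solution'' means unique among sequences in the domain of $W$. $\overline H$ is the Green's function of the system $w_{k+1}=Kw_k$ in $\mathbb F^{2n}$ with $K:=-\begin{pmatrix}F&G\\ B&A\end{pmatrix}^{-1}\begin{pmatrix}A&B\\ G&F\end{pmatrix}$: $\overline H_{k,j}=K^{k-1-j}$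 if $0\leqslant j\leqslant k-1$, $\overline H_{k,j}=-K^{k-1-j}$ if $k\leqslant j\leqslant-1$, and $\overline H_{k,j}=0$ otherwise; for a sequence $d$ in $\mathbb F^{2n}$, $(\overline Hd)_k:=\sum_{j\in\mathbb Z}\overline H_{k,j}d_j$ (a finite sum for each $k$), and $w=\overline Hd$ satisfies $w_{k+1}=Kw_k+d_k$ for all $k\in\mathbb Z$. *)

(* Defs.v *)
From mathcomp Require Import all_boot all_order all_algebra.
From mathcomp Require Import boolp classical_sets functions cardinality fsbigop.
From mathcomp Require Import zify.

Set Implicit Arguments.
Unset Strict Implicit.
Unset Printing Implicit Defensive.

Import Order.TTheory GRing.Theory Num.Theory.
Local Open Scope classical_set_scope.
Local Open Scope ring_scope.

Notation zseq F n := (int -> 'cV[F]_n).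

Definition zshift (T : Type) (x : int -> T) : int -> T := fun k => x (k + 1).

Definition zreflect (T : Type) (x : int -> T) : int -> T := fun k => x (- k).

(* [exprz] needs a nontrivial unit ring, hence a dimension of the form _.+1,
   which n + n is not.  For negative k this is the power of an inverse only
   when K is invertible ([invmx K] is K otherwise). *)
Definition mxexpz (F : fieldType) (m : nat) (K : 'M[F]_m) (k : int) : 'M[F]_m :=
  match k with
  | Posz i => K ^+ i
  | Negz i => invmx K ^+ i.+1
  end.

Lemma mxexpzE (F : fieldType) (m : nat) (K : 'M[F]_m.+1) (k : int) :
  mxexpz K k = K ^ k.
Proof. by case: k => i //=; rewrite exprVn. Qed.

Definition green (F : fieldType) (m : nat) (K : 'M[F]_m) (k j : int) : 'M[F]_m :=
  if (0 <= j) && (j <= k - 1) then mxexpz K (k - 1 - j)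
  else if (k <= j) && (j <= -1) then - mxexpz K (k - 1 - j)
  else 0.

(* \sum_(j \in A) is the sum of a finitely supported family; the support is
   finite by [green_finite_support] below. *)
Definition green_apply (F : fieldType) (m : nat) (K : 'M[F]_m) (d : zseq F m) :
    zseq F m :=
  fun k => \sum_(j \in [set: int]) (green K k j *m d j).

Lemma green_finite_support (F : fieldType) (m : nat) (K : 'M[F]_m)
    (d : zseq F m) (k : int) :
  finite_set [set j : int | green K k j *m d j != 0].
Proof.
pose s : seq int := [seq i%:Z - `|k|%N%:Z | i <- iota 0 (`|k|%N + `|k|%N)].
apply: (@sub_finite_set _ _ [set` s]); last exact: finite_seq.
move=> j /= Hj; apply/mapP.
have [j1 j2] : - `|k|%N%:Z <= (j : int) /\ (j : int) < `|k|%N%:Z.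
  move: Hj; rewrite /green; case: ifP => [|_]; first by lia.
  by case: ifP => [|_]; [lia | rewrite mul0mx eqxx].
exists (absz ((j : int) + `|k|%N%:Z)); last by lia.
by rewrite mem_iota; lia.
Qed.

(* Sequences carry the pointwise module structure.  The map is total for
   convenience: nothing is assumed about its values outside the domain. *)
Record boundary_op (F : fieldType) (n : nat) := BoundaryOp {
  bdom : set (zseq F n);
  bmap :> zseq F n -> 'cV[F]_n;
  bdom0 : bdom 0;
  bdom_linear : forall (a : F) (x y : zseq F n),
    bdom x -> bdom y -> bdom (a *: x + y);
  bmap_linear : forall (a : F) (x y : zseq F n),
    bdom x -> bdom y -> bmap (a *: x + y) = a *: bmap x + bmap y
}.

Definition zupper (F : fieldType) (n : nat) (w : zseq F (n + n)) : zseq F n :=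
  fun k => usubmx (w k).

Definition zlower (F : fieldType) (n : nat) (w : zseq F (n + n)) : zseq F n :=
  fun k => dsubmx (w k).

Definition bdom2 (F : fieldType) (n : nat) (W : boundary_op F n) :
    set (zseq F (n + n)) :=
  [set w | bdom W (zupper w) /\ bdom W (zreflect (zlower w))].

Definition bmap2 (F : fieldType) (n : nat) (W : boundary_op F n)
    (w : zseq F (n + n)) : 'cV[F]_(n + n) :=
  col_mx (W (zupper w)) (W (zreflect (zlower w))).

Definition mxseq_app (F : fieldType) (m : nat) (X : int -> 'M[F]_m)
    (r : 'cV[F]_m) : zseq F m :=
  fun k => X k *m r.

(* The boundary operator applied to each column of X; see [bmap2_mxP]. *)
Definition bmap2_mx (F : fieldType) (n : nat) (W : boundary_op F n)
    (X : int -> 'M[F]_(n + n)) : 'M[F]_(n + n) :=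
  \matrix_(i, j) bmap2 W (fun k => col j (X k)) i 0.

Lemma bmap2_mxP (F : fieldType) (n : nat) (W : boundary_op F n)
    (X : int -> 'M[F]_(n + n)) :
  (forall r, bdom2 W (mxseq_app X r)) ->
  forall r, bmap2_mx W X *m r = bmap2 W (mxseq_app X r).
Proof.
move=> dX r.
have dcol j : bdom2 W (fun k => col j (X k)).
  have := dX (delta_mx j 0); congr (bdom2 W _).
  by apply/funext => k; rewrite /mxseq_app colE.
have lin a w1 w2 : bdom2 W w1 -> bdom2 W w2 ->
    bdom2 W (a *: w1 + w2) /\ bmap2 W (a *: w1 + w2) = a *: bmap2 W w1 + bmap2 W w2.
  move=> [u1 v1] [u2 v2].
  have eu : zupper (a *: w1 + w2) = a *: zupper w1 + zupper w2.
    by apply/funext => k; rewrite /zupper !fctE linearP.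
  have ev : zreflect (zlower (a *: w1 + w2)) =
            a *: zreflect (zlower w1) + zreflect (zlower w2).
    by apply/funext => k; rewrite /zreflect /zlower !fctE linearP.
  rewrite /bdom2 /bmap2 /= eu ev; split; first by split; apply: bdom_linear.
  by rewrite !bmap_linear // scale_col_mx add_col_mx.
have z0 : bdom2 W 0 /\ bmap2 W 0 = 0.
  have e0 : mxseq_app X 0 = 0 by apply/funext => k; rewrite /mxseq_app mulmx0.
  have d0 : bdom2 W 0 by rewrite -e0.
  split=> //; have [_] := lin (-1) _ _ d0 d0.
  by rewrite !scaleN1r !addNr.
have -> : mxseq_app X r = \sum_(j < n + n) r j 0 *: (fun k => col j (X k)).
  apply/funext => k; rewrite /mxseq_app fct_sumE.
  apply/colP => i; rewrite !mxE summxE; apply: eq_bigr => j _.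
  by rewrite fctE !mxE mulrC.
have -> : bmap2_mx W X *m r =
    \sum_(j < n + n) r j 0 *: bmap2 W (fun k => col j (X k)).
  apply/colP => i; rewrite !mxE summxE; apply: eq_bigr => j _.
  by rewrite !mxE mulrC.
suff [_ ->] : bdom2 W (\sum_(j < n + n) r j 0 *: (fun k => col j (X k))) /\
   bmap2 W (\sum_(j < n + n) r j 0 *: (fun k => col j (X k))) =
   \sum_(j < n + n) r j 0 *: bmap2 W (fun k => col j (X k)) by [].
elim/big_rec2: _ => [//|j y w _ [dw <-]].
exact: lin.
Qed.

Definition is_solution (FF : fieldType) (n : nat) (A B F G : 'M[FF]_n)
    (c : zseq FF n) (W : boundary_op FF n) (h : 'cV[FF]_n) (x : zseq FF n) : Prop :=
  [/\ forall k : int,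
        F *m x (k + 1) + G *m x (- k - 1) + A *m x k + B *m x (- k) = c k,
      bdom W x
    & W x = h].

(* Main.v *)
Require Import Defs.
From mathcomp Require Import all_boot all_order all_algebra.
From mathcomp Require Import classical_sets functions fsbigop.
From mathcomp Require Import boolp zify.

Set Implicit Arguments.
Unset Strict Implicit.
Unset Printing Implicit Defensive.

Import Order.TTheory GRing.Theory Num.Theory.
Local Open Scope ring_scope.

(** Pairing a sequence [x] with its reflection removes the reflection from the
    equation: together, the equations at [k] and at [- k - 1] say that
    [w = (x, zreflect x)] satisfies the first-order system
    [w (k + 1) = K *m w k + d k].

    Since [K] is invertible, the solutions of this system over all of [int] are
    exactly the sequences [X r + Y], with [r] the value at 0
    ([recurrence_solutionE]); the boundary conditions [(W, W zreflect) w =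
    (h, h)] then become the linear system [Z r = (h, h) - (W, W zreflect) Y],
    so that they determine [r], and hence [w], when [Z] is invertible
    ([recurrence_bvpE]).  Uniqueness for the reflected problem follows at once.

    For existence, the solution [w = (u, v)] of the first-order problem must be
    shown to have [v = zreflect u].  The system and the boundary conditions are
    both invariant under [(u, v) |-> (zreflect v, zreflect u)]
    ([paired_system_swap], [bmap2_swap]), so that uniqueness for the first-order
    problem forces [w] to be fixed by this involution. *)

(** * First-order recurrences on the integers *)

Section Recurrence.
Variables (F : fieldType) (m : nat) (K : 'M[F]_m).
Hypothesis uK : K \in unitmx.

Definition solves_recurrence (d w : zseq F m) : Prop :=
  forall k : int, w (k + 1) = K *m w k + d k.

(** As [K] is invertible, the recurrence also runs backwards. *)
Lemma recurrence_unique (d w1 w2 : zseq F m) :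
  solves_recurrence d w1 -> solves_recurrence d w2 -> w1 0 = w2 0 -> w1 = w2.
Proof.
move=> s1 s2 e0; apply/funext; elim/int_rec => [//|i IH|i IH].
- have -> : Posz i.+1 = Posz i + 1 by lia.
  by rewrite s1 s2 IH.
- have e : - i.+1%:Z + 1 = - i%:Z by lia.
  apply: (can_inj (mulKmx uK)); apply: (addIr (d (- i.+1%:Z))).
  by rewrite -s1 -s2 e.
Qed.

Lemma mxexpzS (k : int) : mxexpz K (k + 1) = K *m mxexpz K k.
Proof.
case: k => [i|[|i]].
- have -> : Posz i + 1 = Posz i.+1 by lia.
  by rewrite /= exprS.
- by rewrite /= expr1 mulmxV.
- have -> : Negz i.+1 + 1 = Negz i by lia.
  by rewrite /= [_ ^+ i.+2]exprS mulKVmx.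
Qed.

Lemma mxseq_appS (r : 'cV[F]_m) (k : int) :
  mxseq_app (mxexpz K) r (k + 1) = K *m mxseq_app (mxexpz K) r k.
Proof. by rewrite /mxseq_app mxexpzS mulmxA. Qed.

(** As a function of [k], the Green's function solves the recurrence whose
    forcing term is the unit impulse at [j]. *)
Lemma greenS (k j : int) :
  green K (k + 1) j = K *m green K k j + (if j == k then 1%:M else 0).
Proof.
have [->|neq] := eqVneq j k.
  rewrite /green; have [k0|k0] := leP 0 k.
    have -> : (k <= k + 1 - 1) by lia.
    have -> : (k <= k - 1) = false by lia.
    have -> : (k <= -1) = false by lia.
    have -> : k + 1 - 1 - k = 0 by lia.
    by rewrite /= andbF mulmx0 add0r.
  have -> : (k + 1 <= k) = false by lia.
  have -> : (k <= k) && (k <= -1) by lia.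
  have -> : k - 1 - k = -1 by lia.
  by rewrite /= expr1 mulmxN mulmxV // addNr.
rewrite addr0 /green.
have -> : k + 1 - 1 - j = k - 1 - j + 1 by lia.
have -> : (j <= k + 1 - 1) = (j <= k - 1) by lia.
have -> : (k + 1 <= j) = (k <= j) by lia.
rewrite mxexpzS.
by case: ifP => // _; case: ifP => _; rewrite ?mulmxN ?mulmx0.
Qed.

(** A window of indices large enough for several values of [k] at once turns
    the finitely supported sums for these [k] into sums over one list. *)
Lemma green_applyE (d : zseq F m) (N : nat) (k : int) : (`|k| <= N)%N ->
  green_apply K d k =
    \sum_(j <- [seq i%:Z - N%:Z | i <- iota 0 (N + N)]) (green K k j *m d j).
Proof.
move=> kN; rewrite fsbig_seq; last first.
  by rewrite map_inj_uniq ?iota_uniq // => i j; lia.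
rewrite /green_apply; symmetry; apply: fsbig_widen => // j [_ /= jN].
suff -> : green K k j = 0 by rewrite mul0mx.
have {}jN : ~~ ((- N%:Z <= j) && (j < N%:Z)).
  apply/negP => hj; apply: jN; apply/mapP.
  by exists (absz (j + N%:Z)); [rewrite mem_iota; lia | lia].
rewrite /green; case: ifP => [h|_]; first by lia.
by case: ifP => [h|//]; lia.
Qed.

Lemma green_apply_recurrence (d : zseq F m) :
  solves_recurrence d (green_apply K d).
Proof.
move=> k; pose N := (`|k|.+1)%N.
rewrite !(@green_applyE d N) /N; [|lia..].
under eq_bigr => j _ do rewrite greenS mulmxDl -mulmxA.
rewrite big_split -mulmx_sumr; congr (_ + _).
rewrite (bigD1_seq k); last 2 first.
- by apply/mapP; exists (absz (k + N%:Z)); rewrite ?mem_iota /N; lia.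
- by rewrite map_inj_uniq ?iota_uniq // => i j; lia.
rewrite /= eqxx mul1mx big1 ?addr0 // => j /negbTE ->.
by rewrite mul0mx.
Qed.

Lemma green_apply0 (d : zseq F m) : green_apply K d 0 = 0.
Proof. by rewrite (@green_applyE d 0) // big_nil. Qed.

(** The particular solution [green_apply K d] vanishes at 0, so the vector [r]
    below is the value [w 0]. *)
Lemma recurrence_solutionE (d w : zseq F m) :
  solves_recurrence d w <->
  exists r, w = mxseq_app (mxexpz K) r + green_apply K d.
Proof.
have gen r : solves_recurrence d (mxseq_app (mxexpz K) r + green_apply K d).
  move=> k; rewrite !fctE mxseq_appS green_apply_recurrence.
  by rewrite mulmxDr addrA.
split=> [sw | [r ->] //]; exists (w 0).
apply: (recurrence_unique sw (gen _)).
by rewrite fctE green_apply0 addr0 /mxseq_app mul1mx.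
Qed.

End Recurrence.

(** * Boundary value problems for paired sequences *)

Section Boundary.
Variables (F : fieldType) (n : nat) (W : boundary_op F n).

Lemma bmap2D (w1 w2 : zseq F (n + n)) : bdom2 W w1 -> bdom2 W w2 ->
  bdom2 W (w1 + w2) /\ bmap2 W (w1 + w2) = bmap2 W w1 + bmap2 W w2.
Proof.
move=> [u1 v1] [u2 v2].
have eu : zupper (w1 + w2) = 1 *: zupper w1 + zupper w2.
  by rewrite scale1r; apply/funext => k; rewrite /zupper !fctE linearD.
have ev : zreflect (zlower (w1 + w2)) =
          1 *: zreflect (zlower w1) + zreflect (zlower w2).
  rewrite scale1r; apply/funext => k.
  by rewrite /zreflect /zlower !fctE linearD.
rewrite /bdom2 /bmap2 /= eu ev; split; first by split; apply: bdom_linear.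
by rewrite !bmap_linear // !scale1r add_col_mx.
Qed.

(** On the general solution [X r + Y] the boundary condition reads
    [Z *m r + bmap2 W Y = b], which has exactly one solution [r]. *)
Lemma recurrence_bvpE (K : 'M[F]_(n + n)) (d w : zseq F (n + n))
    (b : 'cV[F]_(n + n)) :
  let X := mxexpz K in
  let Y := green_apply K d in
  let Z := bmap2_mx W X in
  K \in unitmx ->
  (forall r, bdom2 W (mxseq_app X r)) -> bdom2 W Y -> Z \in unitmx ->
  [/\ solves_recurrence K d w, bdom2 W w & bmap2 W w = b] <->
  w = mxseq_app X (invmx Z *m (b - bmap2 W Y)) + Y.
Proof.
move=> X Y Z uK dX dY uZ; have bXY r := bmap2D (dX r) dY.
split=> [[/(recurrence_solutionE uK)[r ->] _] | ->].
  by rewrite (bXY r).2 -bmap2_mxP // => <-; rewrite addrK mulKmx.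
split; [|exact: (bXY _).1|].
  by apply/(recurrence_solutionE uK); eexists.
by rewrite (bXY _).2 -bmap2_mxP // mulKVmx // subrK.
Qed.

(** * The reflection symmetry *)

(** The fixed points are the pairs [(x, zreflect x)]. *)
Definition zswap (w : zseq F (n + n)) : zseq F (n + n) :=
  fun k => col_mx (zreflect (zlower w) k) (zreflect (zupper w) k).

Lemma zreflectK (T : Type) : involutive (@zreflect T).
Proof. by move=> x; apply/funext => k; rewrite /zreflect opprK. Qed.

Lemma zupper_swap (w : zseq F (n + n)) :
  zupper (zswap w) = zreflect (zlower w).
Proof. by apply/funext => k; rewrite /zupper col_mxKu. Qed.

Lemma zlower_swap (w : zseq F (n + n)) :
  zlower (zswap w) = zreflect (zupper w).
Proof. by apply/funext => k; rewrite /zlower col_mxKd. Qed.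

Lemma bdom2_swap (w : zseq F (n + n)) : bdom2 W w -> bdom2 W (zswap w).
Proof.
by case=> du dv; split; rewrite ?zupper_swap ?zlower_swap ?zreflectK.
Qed.

Lemma bmap2_swap (w : zseq F (n + n)) :
  bmap2 W (zswap w) = col_mx (dsubmx (bmap2 W w)) (usubmx (bmap2 W w)).
Proof.
by rewrite /bmap2 zupper_swap zlower_swap zreflectK col_mxKu col_mxKd.
Qed.

End Boundary.

Section PairedSystem.
Variables (FF : fieldType) (n : nat) (A B F G : 'M[FF]_n) (c : zseq FF n).

Let M := block_mx F G B A.
Let N := block_mx A B G F.
Let C : zseq FF (n + n) := fun k => col_mx (c k) (zshift (zreflect c) k).

Definition paired_system (w : zseq FF (n + n)) : Prop :=
  forall k : int, M *m w (k + 1) + N *m w k = C k.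

Lemma paired_systemE (w : zseq FF (n + n)) :
  paired_system w <->
  forall k : int,
    F *m zupper w (k + 1) + G *m zlower w (k + 1)
      + A *m zupper w k + B *m zlower w k = c k /\
    B *m zupper w (k + 1) + A *m zlower w (k + 1)
      + G *m zupper w k + F *m zlower w k = c (- k - 1).
Proof.
have E k : M *m w (k + 1) + N *m w k = col_mx
    (F *m zupper w (k + 1) + G *m zlower w (k + 1)
      + A *m zupper w k + B *m zlower w k)
    (B *m zupper w (k + 1) + A *m zlower w (k + 1)
      + G *m zupper w k + F *m zlower w k).
  rewrite -[w (k + 1)]vsubmxK -[w k]vsubmxK !mul_block_col add_col_mx.
  by rewrite !addrA.
split=> sw k; move: (sw k); rewrite ?E /C /zshift /zreflect opprD.
  by move/eq_col_mx.
by case=> -> ->.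
Qed.

Lemma paired_system_recurrence (w : zseq FF (n + n)) : M \in unitmx ->
  paired_system w <->
  solves_recurrence (- (invmx M *m N)) (fun k => invmx M *m C k) w.
Proof.
move=> uM; split=> sw k.
  rewrite -(sw k) mulmxDr mulKmx // mulNmx mulmxA.
  by rewrite [_ + (_ *m _) *m _]addrC addKr.
rewrite sw mulmxDr mulKVmx // mulNmx mulmxN -mulmxA mulKVmx //.
by rewrite addrAC addNr add0r.
Qed.

(** Reflecting [k] to [- k - 1] exchanges the two block rows of the system. *)
Lemma paired_system_swap (w : zseq FF (n + n)) :
  paired_system w -> paired_system (zswap w).
Proof.
move/paired_systemE => sw; apply/paired_systemE => k.
have [] := sw (- k - 1).
rewrite zupper_swap zlower_swap /zreflect subrK !opprD !opprK addrK.
move=> <- <-; split; by rewrite [RHS](ACl (4*3*2*1)).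
Qed.

(** For a pair [(x, zreflect x)], the second block row of the system at [k] is
    the first one at [- k - 1], so only the reflected equation for [x] remains. *)
Lemma paired_system_reflect (w : zseq FF (n + n)) :
  zswap w = w ->
  paired_system w <->
  forall k : int, F *m zupper w (k + 1) + G *m zupper w (- k - 1)
    + A *m zupper w k + B *m zupper w (- k) = c k.
Proof.
move=> fw; have lw k : zlower w k = zupper w (- k).
  by rewrite -{1}fw zlower_swap.
split=> [/paired_systemE sw k | sx].
  by have [] := sw k; rewrite !lw opprD.
apply/paired_systemE => k; rewrite !lw opprD; split; first exact: sx.
rewrite -sx subrK opprD !opprK addrK.
by rewrite [LHS](ACl (4*3*2*1)).
Qed.

End PairedSystem.

(** * The reflected problem *)

Theorem theorem4p5 (FF : fieldType) (n : nat) (n_ge1 : (1 <= n)%N)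
    (A B F G : 'M[FF]_n)
    (c : zseq FF n) (h : 'cV[FF]_n) (W : boundary_op FF n) :
  let M := block_mx F G B A in
  let N := block_mx A B G F in
  M \in unitmx -> N \in unitmx ->
  let K := - (invmx M *m N) in
  let X := mxexpz K in
  let Y := green_apply K
             (fun k => invmx M *m col_mx (c k) (zshift (zreflect c) k)) in
  let Z := bmap2_mx W X in
  (forall r : 'cV[FF]_(n + n), bdom2 W (mxseq_app X r)) ->
  bdom2 W Y ->
  Z \in unitmx ->
  let u := zupper
             (mxseq_app X (invmx Z *m (col_mx h h - bmap2 W Y)) + Y) in
  is_solution A B F G c W h u /\
  (forall x : zseq FF n, is_solution A B F G c W h x -> x = u).
Proof.
move=> M N uM uN K X Y Z dX dY uZ u.
have uK : K \in unitmx.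
  by rewrite /K -scaleN1r unitmxZ ?unitrN1 // unitmx_mul unitmx_inv uM uN.
have bvp w := recurrence_bvpE w (col_mx h h) uK dX dY uZ.
have sys := paired_system_recurrence c _ uM.
rewrite {}/u; set w := mxseq_app _ _ + _.
have [/sys sw dw bw] := (bvp w).2 erefl.
(* [zswap w] solves the same boundary value problem, because the two blocks of
   the boundary value [col_mx h h] are equal. *)
have fw : zswap w = w.
  apply/bvp; split; last by rewrite bmap2_swap bw col_mxKu col_mxKd.
    by apply/sys/paired_system_swap.
  exact: bdom2_swap.
split.
  split; [exact/paired_system_reflect | exact: dw.1 |].
  by have /eq_col_mx[] := bw.
move=> x [sx dx bx].
pose wx : zseq FF (n + n) := fun k => col_mx (x k) (zreflect x k).
have ux : zupper wx = x by apply/funext => k; rewrite /zupper col_mxKu.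
have lx : zlower wx = zreflect x by apply/funext => k; rewrite /zlower col_mxKd.
have fx : zswap wx = wx.
  by apply/funext => k; rewrite /zswap ux lx zreflectK.
suff <- : wx = w by [].
apply/bvp; split.
- by apply/sys/paired_system_reflect; rewrite ?ux.
- by rewrite /bdom2 /= ux lx zreflectK.
- by rewrite /bmap2 ux lx zreflectK bx.
Qed.
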